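(* Let $m\ge 2$ and $t\ge 1$ be integers and let $G$ be a graph. If $G$ contains the complete graph $K_t$ as a totally odd subdivision, then the $m$-level generalised Mycielskian $\mu_m(G)$ contains $K_{t+1}$ as a totally odd subdivision.
   Context: All graphs are finite, undirected and loopless. Given a graph $G$ and an integer $m\ge 2$, the $m$-level generalised Mycielskian $\mu_m(G)$ of $G$ is the graph with vertex set $(V(G)\times\{0,1,\dots,m-1\})\cup\{w\}$, where $w$ is a new vertex, and with the following edges: for every edge $uv\in E(G)$, the edge $(u,0)(v,0)$; for every edge $uv\in E(G)$ (in both orders of its endpoints) and every $i\in\{0,1,\dots,m-2\}$, the edge $(u,i)(v,i+1)$; and for every $u\in V(G)$, the edge $(u,m-1)w$. A graph $G$ contains a graph $H$ as a totally odd subdivision if there are an injection $\varphi\colon V(H)\to V(G)$ and, for every edge $uv\in E(H)$, a path $P_{uv}$ in $G$ with endpoints $\varphi(u)$ and $\varphi(v)$ and of odd length (number of edges), such that the paths $P_{uv}$ ($uv\in E(H)$) are pairwise edge-disjoint and pairwise internally vertex-disjoint, and no vertex of $\varphi(V(H))$ (these vertices are called terminals) is an internal vertex of any of these paths. *)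

(* Defs.v *)
From mathcomp Require Import all_boot.

Set Implicit Arguments.
Unset Strict Implicit.
Unset Printing Implicit Defensive.

Record sgraph := SGraph {
  svertex :> finType;
  sedge : rel svertex;
  sedge_sym : symmetric sedge;
  sedge_irr : irreflexive sedge }.

Definition edge_set (G : sgraph) : {set {set G}} :=
  [set [set uv.1; uv.2] | uv : G * G & sedge uv.1 uv.2].

Section CompleteGraph.
Variable n : nat.

Definition complete_rel : rel 'I_n := fun i j => i != j.

Lemma complete_rel_sym : symmetric complete_rel.
Proof. by move=> i j; rewrite /complete_rel eq_sym. Qed.

Lemma complete_rel_irr : irreflexive complete_rel.
Proof. by move=> i; rewrite /complete_rel eqxx. Qed.

Definition complete_graph : sgraph :=
  SGraph complete_rel_sym complete_rel_irr.
End CompleteGraph.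

(* [Some (u, i)] is the copy of [u] at level [i], and [None] is the new       *)
(* vertex w.                                                                  *)
Section Mycielskian.
Variables (m : nat) (G : sgraph).

Definition mycielskian_rel : rel (option (G * 'I_m)) := fun x y =>
  match x, y with
  | Some (u, i), Some (v, j) =>
      sedge u v && [|| (i == 0 :> nat) && (j == 0 :> nat),
                       j == i.+1 :> nat | i == j.+1 :> nat]
  | Some (_, i), None | None, Some (_, i) => i == m.-1 :> nat
  | None, None => false
  end.

Lemma mycielskian_rel_sym : symmetric mycielskian_rel.
Proof.
move=> [[u i]|] [[v j]|] //=; rewrite sedge_sym; congr (_ && _).
by rewrite andbC; congr (_ || _); rewrite orbC.
Qed.

Lemma mycielskian_rel_irr : irreflexive mycielskian_rel.
Proof. by move=> [[u i]|] //=; rewrite sedge_irr. Qed.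

Definition mycielskian : sgraph :=
  SGraph mycielskian_rel_sym mycielskian_rel_irr.
End Mycielskian.

(* A path is given by its sequence of vertices, read from either end; it has  *)
(* one edge fewer than it has vertices.                                       *)
Section Paths.
Variable G : sgraph.
Implicit Types (x y : G) (p : seq G).

Definition is_path_between x y p : bool :=
  if p is z :: q then
    [&& path (@sedge G) z q, uniq p
      & ((z == x) && (last z q == y)) || ((z == y) && (last z q == x))]
  else false.

Definition path_length p : nat := (size p).-1.

Definition path_edges p : seq {set G} :=
  [seq [set ab.1; ab.2] | ab <- zip p (behead p)].

Definition internal_vertices p : seq G :=
  if p is z :: q then behead (belast z q) else [::].
End Paths.

Definition contains_totally_odd_subdivision (H G : sgraph) : Prop :=
  exists (phi : H -> G) (P : {set H} -> seq G),
    [/\ injective phi,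
        forall u v : H, sedge u v ->
          is_path_between (phi u) (phi v) (P [set u; v])
          /\ odd (path_length (P [set u; v])),
        {in edge_set H &, forall A B, A != B ->
           forall a : {set G}, a \in path_edges (P A) ->
             a \notin path_edges (P B)},
        {in edge_set H &, forall A B, A != B ->
           forall x : G, x \in internal_vertices (P A) ->
             x \notin internal_vertices (P B)}
      & {in edge_set H, forall A (u : H),
           phi u \notin internal_vertices (P A)}].

(* Main.v *)
Require Import Defs.
From mathcomp Require Import all_boot.

Set Implicit Arguments.
Unset Strict Implicit.
Unset Printing Implicit Defensive.

(** Let the given subdivision of [K_t] have terminals [x_i], and write [P_ij]
    for its paths.  Level 0 of the Mycielskian is a copy of the base graph, so
    it contains this subdivision; one more terminal is needed, together with
    odd paths to the others.  How it is found depends on the lengths of the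
    paths.

    If some [P_uv] is a single edge, the new terminal is the copy of [x_u] at
    level 1 ([split_linkage]).  Each path [P_uj] is doubled by zigzagging
    between levels 0 and 1 in the two opposite phases: one phase starts at
    level 0, the other at level 1, they share no internal vertex, and both can
    step to [x_j] at level 0 at the end ([path_zigzag], [zigzag_disjoint]).  The
    two copies of [x_u] are joined through [w]: from level 1 climb to [w] and
    from there descend to level 0, alternating between copies of [x_u] and of
    [x_v].  With [m] levels this takes [m - 1] steps up and [m] steps down, an
    odd number.  It meets no other path since it lies above copies of terminals
    only, and it descends to [x_u] through the copy of [x_v] at level 1.

    If all paths have length at least 3 and [t >= 3], the new terminal is [w]
    ([apex_linkage]).  Fix a map [succ] of the terminals such that the pairs
    [{i, succ i}] are pairwise distinct, and let [a], [b] be the first two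
    internal vertices of the path from [x_i] to [x_(succ i)].  The vertex [x_i]
    is joined to [w] by a path above [a] and [b].  For odd [m] it alternates
    between [a] and [b] from level 1 up, and has length [m].  For even [m] it
    needs one extra step, taken at level 0 from [x_i] to [a], before climbing
    from there; the path from [x_i] to [x_(succ i)], which needed [a] at
    level 0, uses the copy of [a] at level 1 instead ([ladder], [detour]).

    For [t <= 2] there is nothing to subdivide: [K_2] can be replaced by a
    single edge, which brings [t = 2] to the first case, and for [t = 1] any
    edge at [w] will do. *)

(** * Subdivisions of complete graphs as families of internal paths *)

(** A totally odd subdivision of a complete graph on [T], in a form without the
    redundancies of the usual one: [p i j] lists the internal vertices of the
    path from [i] to [j], so that odd length means that [p i j] has even size,
    and the relation [r] tells which of the two orientations of a pair are
    described by [p].  That the paths are edge-disjoint is a consequence. *)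
Definition odd_linkage (T : finType) (G : sgraph) (phi : T -> G) (r : rel T)
    (p : T -> T -> seq G) : Prop :=
  [/\ injective phi,
      forall i j, r i j ->
        [/\ path (@sedge G) (phi i) (rcons (p i j) (phi j)), uniq (p i j)
          & ~~ odd (size (p i j))],
      forall i j k, r i j -> phi k \notin p i j
    & forall i j k l x, r i j -> r k l -> x \in p i j -> x \in p k l ->
        [set i; j] = [set k; l]].

Lemma path_rev_rcons (T : eqType) (e : rel T) x q y :
  symmetric e -> path e x (rcons q y) -> path e y (rcons (rev q) x).
Proof.
move=> e_sym e_q.
have := rev_path e x (rcons q y); rewrite last_rcons belast_rcons rev_cons.
by move=> ->; rewrite (eq_path (e' := e)) // => a b; rewrite e_sym.
Qed.

(** The path of a pair may be listed from either end; [p] is its interior as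
    read from [x]. *)
Lemma is_path_between_inner (G : sgraph) (x y : G) s :
    x != y -> is_path_between x y s -> odd (path_length s) ->
  let p := if ohead s == Some x then internal_vertices s
           else rev (internal_vertices s) in
  [/\ path (@sedge G) x (rcons p y), uniq p & ~~ odd (size p)].
Proof.
case: s => [//|z q] neq_xy /= /and3P[]; rewrite /path_length /=.
case/lastP: q => [|q y'] /=.
  by move=> _ _ /orP[]/andP[/eqP-> /eqP eq_xy]; rewrite eq_xy eqxx in neq_xy.
rewrite last_rcons belast_rcons /= size_rcons /= rcons_uniq mem_rcons.
move=> e_q /and3P[_ _ uniq_q] ends even_q.
case/orP: ends e_q => /andP[/eqP-> /eqP->] e_q.
  by rewrite (eqxx (Some x)).
have -> : (Some y == Some x) = false.
  by apply/eqP=> -[eq_yx]; rewrite eq_yx eqxx in neq_xy.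
rewrite rev_uniq size_rev; split=> //.
by apply: path_rev_rcons e_q; apply: sedge_sym.
Qed.

Lemma linkage_of_subdivision t (G : sgraph) :
    contains_totally_odd_subdivision (complete_graph t) G ->
  exists (phi : 'I_t -> G) p, odd_linkage phi (fun i j => i != j) p.
Proof.
case=> phi [P [phi_inj Ppath _ Pdisj Pterm]].
have edgeE (i j : 'I_t) : i != j -> [set i; j] \in edge_set (complete_graph t).
  by move=> neq_ij; apply/imsetP; exists (i, j); rewrite ?inE.
pose p i j := if ohead (P [set i; j]) == Some (phi i)
              then internal_vertices (P [set i; j])
              else rev (internal_vertices (P [set i; j])).
have mem_p i j : p i j =i internal_vertices (P [set i; j]).
  by rewrite /p => x; case: ifP => // _; rewrite mem_rev.
exists phi, p; split=> // [i j neq_ij|i j k neq_ij|i j k l x neq_ij neq_kl].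
- have [Pij odd_ij] := Ppath i j neq_ij.
  by apply: is_path_between_inner Pij odd_ij; rewrite (inj_eq phi_inj).
- by rewrite mem_p; apply: Pterm; apply: edgeE.
rewrite !mem_p => x_ij x_kl; apply/eqP/negPn/negP => neq.
by have /negP := Pdisj _ _ (edgeE _ _ neq_ij) (edgeE _ _ neq_kl) neq x x_ij.
Qed.

(** The reason why edge-disjointness is automatic: an edge of a path either has
    an internal vertex as an endpoint, which no other path contains, or joins
    the two ends, which determine the pair of terminals. *)
Lemma path_edges_inner (G : sgraph) (x y : G) q a :
    a \in path_edges (x :: rcons q y) ->
  {subset a <= x :: rcons q y} /\
  ((q = [::] /\ a = [set x; y]) \/ (exists2 c, c \in q & c \in a)).
Proof.
rewrite /path_edges /=; elim: q x => [|z q IHq] x /=.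
  rewrite inE => /eqP->; split; last by left.
  by move=> c; rewrite !inE.
rewrite inE => /predU1P[->|/IHq[sub_a inner_a]].
  split; last by right; exists z; rewrite !inE eqxx ?orbT.
  by move=> c; rewrite !inE => /orP[]->; rewrite ?orbT.
split; first by move=> c /sub_a; rewrite !inE => ->; rewrite orbT.
right; case: inner_a => [[_ ->]|[c c_q c_a]].
  by exists z; rewrite !inE eqxx.
by exists c; rewrite // inE c_q orbT.
Qed.

(** Here [r] need not be a tournament: when it relates a pair both ways, either
    orientation can be chosen.  This lets the constructions below constrain the
    orientation of those pairs only for which it matters. *)
Lemma subdivision_of_linkage n (T : finType) (G : sgraph) (phi : T -> G)
    (r : rel T) p :
    #|T| = n -> irreflexive r -> (forall i j, i != j -> r i j || r j i) ->
  odd_linkage phi r p ->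
  contains_totally_odd_subdivision (complete_graph n) G.
Proof.
move=> <- r_irr r_total [phi_inj p_path p_term p_disj].
pose tm (i : 'I_#|T|) : T := enum_val i.
pose sel (A : {set 'I_#|T|}) :=
  [pick ij : T * T | r ij.1 ij.2 && (tm @: A == [set ij.1; ij.2])].
pose P A := if sel A is Some ij then phi ij.1 :: rcons (p ij.1 ij.2) (phi ij.2)
            else [::].
have tm_inj : injective tm by apply: enum_val_inj.
have PE A : A \in edge_set (complete_graph #|T|) ->
    exists i j, [/\ r i j, tm @: A = [set i; j]
                  & P A = phi i :: rcons (p i j) (phi j)].
  case/imsetP=> -[i j]; rewrite inE /= => neq_ij ->; rewrite /P /sel.
  case: pickP => [[k l] /andP[/= r_kl /eqP eqA]|none]; first by exists k, l.
  have /r_total/orP[r_ij|r_ij] : tm i != tm j by rewrite (inj_eq tm_inj).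
    by have := none (tm i, tm j); rewrite /= r_ij imsetU1 imset_set1 eqxx.
  by have := none (tm j, tm i); rewrite /= r_ij imsetU1 imset_set1 setUC eqxx.
have PinE i j : internal_vertices (phi i :: rcons (p i j) (phi j)) = p i j.
  by rewrite /= belast_rcons.
exists (phi \o tm), P; split.
- exact: inj_comp.
- move=> i j neq_ij.
  have /PE[k [l [r_kl eq_ij ->]]] : [set i; j] \in edge_set (complete_graph #|T|).
    by apply/imsetP; exists (i, j); rewrite ?inE.
  have [e_kl uniq_kl odd_kl] := p_path k l r_kl.
  have neq_kl : k != l by apply: contraTneq r_kl => ->; rewrite r_irr.
  split; last by rewrite /path_length /= size_rcons.
  rewrite /= e_kl rcons_uniq mem_rcons inE negb_or (inj_eq phi_inj) neq_kl.
  rewrite !p_term // uniq_kl last_rcons !(inj_eq phi_inj) /=.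
  rewrite imsetU1 imset_set1 in eq_ij.
  have: k \in [set tm i; tm j] by rewrite eq_ij !inE eqxx.
  have: l \in [set tm i; tm j] by rewrite eq_ij !inE eqxx orbT.
  rewrite !inE; case/orP=> /eqP eq_l; case/orP=> /eqP eq_k;
    by move: neq_kl; rewrite eq_k eq_l !eqxx ?orbT.
- move=> A B /PE[i [j [r_ij eqA ->]]] /PE[k [l [r_kl eqB ->]]] neqAB a.
  have neq_s : [set i; j] != [set k; l].
    by rewrite -eqA -eqB (inj_eq (imset_inj tm_inj)).
  case/path_edges_inner=> sub_ij in_ij; apply/negP.
  case/path_edges_inner=> sub_kl [[_ a_kl]|[c c_kl /sub_ij]]; last first.
    rewrite inE mem_rcons inE => /predU1P[eqc|/predU1P[eqc|c_ij]].
    + by have := p_term _ _ i r_kl; rewrite -eqc c_kl.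
    + by have := p_term _ _ j r_kl; rewrite -eqc c_kl.
    by case/eqP: neq_s; apply: p_disj c_ij c_kl.
  case: in_ij => [[_ a_ij]|[c c_ij]]; last first.
    rewrite a_kl !inE => /orP[]/eqP eqc.
    + by have := p_term _ _ k r_ij; rewrite -eqc c_ij.
    by have := p_term _ _ l r_ij; rewrite -eqc c_ij.
  case/eqP: neq_s; apply: (imset_inj phi_inj).
  by rewrite !imsetU1 !imset_set1 -a_ij.
- move=> A B /PE[i [j [r_ij eqA ->]]] /PE[k [l [r_kl eqB ->]]] neqAB x.
  rewrite !PinE => x_ij; apply: contra neqAB => x_kl.
  by rewrite -(inj_eq (imset_inj tm_inj)) eqA eqB (p_disj _ _ _ _ _ _ _ x_ij x_kl).
move=> A /PE[i [j [r_ij eqA ->]]] u; rewrite PinE; exact: p_term.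
Qed.

(** * Paths in the Mycielskian as sequences of levelled vertices *)

(** The number [n.+2] of levels makes ['I_n.+2] inhabited, so that levels can be
    handled as natural numbers bounded by [n.+1]. *)
Section Layers.
Variables (n : nat) (G : sgraph).
Local Notation M := (mycielskian n.+2 G).

Definition at_level (z : G * nat) : M := Some (z.1, inord z.2).

Definition layer_adj (a b : G * nat) : bool :=
  sedge a.1 b.1 &&
  [|| (a.2 == 0) && (b.2 == 0), b.2 == a.2.+1 | a.2 == b.2.+1].

Lemma at_level_inj a b :
  a.2 <= n.+1 -> b.2 <= n.+1 -> at_level a = at_level b -> a = b.
Proof.
case: a b => [x i] [y j] /= le_i le_j [-> /(congr1 val)].
by rewrite /= !inordK // => ->.
Qed.

Lemma sedge_at_level a b : a.2 <= n.+1 -> b.2 <= n.+1 ->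
  sedge (at_level a) (at_level b) = layer_adj a b.
Proof. by move=> le_a le_b; rewrite /= /layer_adj !inordK. Qed.

Lemma sedge_at_level_top x : sedge (at_level (x, n.+1)) (None : M).
Proof. by rewrite /= inordK. Qed.

Lemma path_at_level a s : all (fun z => z.2 <= n.+1) (a :: s) ->
  path layer_adj a s -> path (@sedge M) (at_level a) (map at_level s).
Proof.
elim: s a => [//|b s IHs] a /= /and3P[le_a le_b le_s] /andP[ab e_s].
apply/andP; split; last by apply: IHs; rewrite //= le_b.
by have := sedge_at_level le_a le_b; rewrite ab.
Qed.

Lemma at_level_uniq s : all (fun z => z.2 <= n.+1) s ->
  uniq (map at_level s) = uniq s.
Proof.
move/allP=> le_s; apply: map_inj_in_uniq => a b /le_s le_a /le_s.
exact: at_level_inj.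
Qed.

Lemma mem_at_level a s : a.2 <= n.+1 -> all (fun z => z.2 <= n.+1) s ->
  (at_level a \in map at_level s) = (a \in s).
Proof.
move=> le_a /allP le_s; apply/mapP/idP => [[b b_s]|a_s]; last by exists a.
by move/at_level_inj-> => //; apply: le_s.
Qed.

Lemma none_at_level s : (None : M) \in map at_level s = false.
Proof. by apply/mapP=> -[]. Qed.

End Layers.
Arguments at_level : clear implicits.

(** * Lifting a path of the base graph *)

Section Lifts.
Variable G : sgraph.
Implicit Types (x y : G) (s : seq G).

Definition ground s : seq (G * nat) := [seq (x, 0) | x <- s].

Fixpoint zigzag (b : bool) s : seq (G * nat) :=
  if s is x :: s' then (x, b : nat) :: zigzag (~~ b) s' else [::].

(** The vertex at level [l] of a climb that alternates between [x], at odd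
    levels, and [y], at even levels. *)
Definition rung x y l : G * nat := (if odd l then x else y, l).

(** The start may be at level 1 as well, since a vertex at level 1 sees its
    neighbours at level 0; a detour uses this after its first vertex. *)
Lemma path_ground (b : bool) x s y : path (@sedge G) x (rcons s y) ->
  path (@layer_adj G) (x, b : nat) (rcons (ground s) (y, 0)).
Proof.
elim: s x b => [|z s IHs] x b /=; rewrite /layer_adj /=.
  by rewrite !andbT => ->; case: b.
by case/andP=> -> /(IHs _ false)->; case: b.
Qed.

(** Both phases can end at level 0: the last step either descends from level 1
    or stays at level 0, where base edges are present. *)
Lemma path_zigzag b x s y : path (@sedge G) x (rcons s y) ->
  path (@layer_adj G) (x, ~~ b : nat) (rcons (zigzag b s) (y, 0)).
Proof.
elim: s x b => [|z s IHs] x b /=; rewrite /layer_adj /=.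
  by rewrite !andbT => ->; case: b.
by case/andP=> -> /(IHs _ (~~ b)); rewrite negbK => ->; case: b.
Qed.

Lemma unzip1_zigzag b s : [seq z.1 | z <- zigzag b s] = s.
Proof. by elim: s b => //= x s IHs b; rewrite IHs. Qed.

Lemma size_zigzag b s : size (zigzag b s) = size s.
Proof. by rewrite -[in RHS](unzip1_zigzag b s) size_map. Qed.

Lemma zigzag_uniq b s : uniq s -> uniq (zigzag b s).
Proof. by move=> us; apply: (@map_uniq _ _ fst); rewrite unzip1_zigzag. Qed.

Lemma mem_zigzag b s z : z \in zigzag b s -> z.1 \in s /\ z.2 <= 1.
Proof.
elim: s b => //= x s IHs b; rewrite inE => /predU1P[->|/IHs[z_s ->]].
  by rewrite inE eqxx; case: b.
by rewrite inE z_s orbT.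
Qed.

Lemma zigzag_disjoint b s z :
  uniq s -> z \in zigzag b s -> z \notin zigzag (~~ b) s.
Proof.
elim: s b => //= x s IHs b /andP[x_s us]; rewrite !inE.
case/predU1P=> [->|z_s].
  rewrite negb_or; apply/andP; split.
    by rewrite xpair_eqE; case: (b); rewrite andbF.
  by apply: contra x_s => /mem_zigzag[].
rewrite negb_or IHs // andbT; apply: contraNneq x_s => eq_z.
by have [] := mem_zigzag z_s; rewrite eq_z.
Qed.

Lemma mem_ground s z : z \in ground s -> z.1 \in s /\ z.2 = 0.
Proof. by case/mapP=> x x_s ->. Qed.

Lemma path_rungs x y l k : sedge x y ->
  path (@layer_adj G) (rung x y l) [seq rung x y i | i <- iota l.+1 k].
Proof.
move=> xy; elim: k l => //= k IHk l; rewrite IHk andbT /layer_adj /rung /=.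
by rewrite eqxx orbT andbT; case: (odd l) => //=; rewrite sedge_sym.
Qed.

Lemma rungs_uniq x y l k : uniq [seq rung x y i | i <- iota l k].
Proof. by rewrite map_inj_uniq ?iota_uniq // => i j []. Qed.

Lemma mem_rungs x y l k z : z \in [seq rung x y i | i <- iota l k] ->
  z = rung x y z.2 /\ l <= z.2 < l + k.
Proof. by case/mapP=> i; rewrite mem_iota => ? ->. Qed.

End Lifts.

(** * Routes to the apex *)

Section Subdivisions.
Variables (n : nat) (G : sgraph).
Local Notation M := (mycielskian n.+2 G).
Local Notation at_level := (at_level n G).

Definition climb (x y : G) l : seq (G * nat) :=
  [seq rung x y i | i <- iota l.+1 (n.+1 - l)].

Lemma mem_climb x y l z : l <= n.+1 -> z \in climb x y l ->
  z = rung x y z.2 /\ l < z.2 <= n.+1.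
Proof. by move=> le_l /mem_rungs; rewrite addSn subnKC. Qed.

Lemma climb_low x y l : l <= n.+1 -> all (fun z => z.2 <= n.+1) (climb x y l).
Proof. by move=> le_l; apply/allP=> z /(mem_climb le_l)[_ /andP[]]. Qed.

Lemma path_climb x y l : sedge x y -> l <= n.+1 ->
  path (@sedge M) (at_level (rung x y l))
       (rcons (map at_level (climb x y l)) None).
Proof.
move=> xy le_l; rewrite rcons_path path_at_level ?path_rungs //=; last first.
  by rewrite le_l climb_low.
rewrite last_map (_ : last _ _ = rung x y n.+1); first exact: sedge_at_level_top.
rewrite /climb (last_map (rung x y)) -[in RHS](subnKC le_l).
congr (rung x y _); move: (n.+1 - l) => k {le_l}.
by elim: k l => [|k IHk] l; rewrite /= ?addn0 // IHk addnS.
Qed.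

(** A route to the apex above the first two vertices of [s].  The number of
    levels has the parity of [n]; if it is even, the route enters [s] at level 0
    instead of level 1, which makes it one step longer. *)
Definition ladder (s : seq G) : seq (G * nat) :=
  if s is a :: b :: _ then
    if odd n then climb a b 0 else (a, 0) :: climb b a 0
  else [::].

(** The path along [s] that leaves room for [ladder s]: for even [n] the ladder
    occupies the first vertex of [s] at level 0, and the copy at level 1 takes
    its place. *)
Definition detour (s : seq G) : seq (G * nat) :=
  if s is a :: s' then (a, ~~ odd n : nat) :: ground s' else [::].

Lemma mem_ladder s z : z \in ladder s -> z.1 \in s /\ z.2 <= n.+1.
Proof.
case: s => [|a [|b s]] //; rewrite /ladder; case: odd.
  case/mem_climb=> // -> /andP[_ le_z]; split=> //=.
  by case: odd; rewrite !inE eqxx ?orbT.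
rewrite inE => /predU1P[->|]; first by rewrite !inE eqxx.
case/mem_climb=> // -> /andP[_ le_z]; split=> //=.
by case: odd; rewrite !inE eqxx ?orbT.
Qed.

Lemma mem_detour s z : z \in detour s -> z.1 \in s /\ z.2 <= 1.
Proof.
case: s => [|a s] //; rewrite inE => /predU1P[->|/mem_ground[z_s ->]].
  by rewrite inE eqxx; case: odd.
by rewrite inE z_s orbT.
Qed.

Lemma ladder_detour_disjoint s z :
  uniq s -> z \in ladder s -> z \notin detour s.
Proof.
case: s => [|a [|b s]] // /andP[]; rewrite inE negb_or => /andP[neq_ab a_s] _.
rewrite /ladder /detour inE negb_or; case: (odd n).
  case/mem_climb=> // _ /andP[lt_z _].
  apply/andP; split; first by apply: contraTneq lt_z => ->.
  by apply/negP=> /mem_ground[_ z0]; rewrite z0 in lt_z.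
rewrite inE => /predU1P[->|].
  apply/andP; split; first by rewrite xpair_eqE andbF.
  by apply/negP=> /mem_ground[]; rewrite inE (negPf neq_ab) (negPf a_s).
case/mem_climb=> // eq_z /andP[lt_z _].
apply/andP; split; last first.
  by apply/negP=> /mem_ground[_ z0]; rewrite z0 in lt_z.
by apply: contraNneq neq_ab => eq_a; move: eq_z; rewrite eq_a => -[->].
Qed.

Lemma ladderP x s y :
    path (@sedge G) x (rcons s y) -> ~~ odd (size s) -> 0 < size s ->
  [/\ path (@sedge M) (at_level (x, 0)) (rcons (map at_level (ladder s)) None),
      uniq (ladder s) & ~~ odd (size (ladder s))].
Proof.
case: s => [|a [|b s]] //= /and3P[xa ab _] _ _.
have ba : sedge b a by rewrite sedge_sym.
case: ifP => odd_n; split.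
- have -> : climb a b 0 = rung a b 1 :: climb a b 1.
    by rewrite /climb subSS !subn0.
  rewrite map_cons rcons_cons; apply/andP; split; last exact: path_climb.
  by apply: etrans (sedge_at_level _ _) _; rewrite // /layer_adj /= xa.
- exact: rungs_uniq.
- by rewrite !size_map size_iota /= negbK.
- rewrite map_cons rcons_cons; apply/andP; split.
    by apply: etrans (sedge_at_level _ _) _; rewrite // /layer_adj /= xa.
  exact: (path_climb (l := 0)).
- rewrite cons_uniq rungs_uniq andbT; apply/negP.
  by case/mem_climb.
by rewrite /= !size_map size_iota /= negbK odd_n.
Qed.

Lemma detourP x s y :
    path (@sedge G) x (rcons s y) -> uniq s ->
  [/\ path (@layer_adj G) (x, 0) (rcons (detour s) (y, 0)),
      uniq (detour s) & size (detour s) = size s].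
Proof.
case: s => [|a s] /=; first by rewrite /layer_adj /= !andbT.
case/andP=> xa e_s /andP[a_s u_s]; rewrite size_map; split=> //.
  by rewrite path_ground // andbT /layer_adj /= xa; case: odd.
rewrite map_inj_uniq ?u_s ?andbT; last by move=> ? ? [].
by apply: contra a_s => /mem_ground[].
Qed.

(** * Doubling a terminal incident with a path of length one *)

Section Linkage.
Variables (T : finType) (phi : T -> G) (p : T -> T -> seq G).
Hypothesis p_link : odd_linkage phi (fun i j => i != j) p.

Section ShortPath.
Variables u v : T.
Hypotheses (neq_uv : u != v) (p_uv : p u v = [::]).

Definition split_terminal (i : option T) : G * nat :=
  if i is Some i then (phi i, 0) else (phi u, 1).

(** Paths between [Some u] and another [Some j] have to be read from [u], where
    the phase of their zigzag is prescribed. *)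
Definition split_pair (i j : option T) : bool :=
  match i, j with
  | Some i, Some j => (i != j) && (j != u)
  | None, Some _ => true
  | _, None => false
  end.

(** The climb from level 1 and the one from level 0 have lengths that differ by
    one, so the path has odd length; they take [phi u] and [phi v] at opposite
    parities of the level, so they are disjoint. *)
Definition split_loop : seq M :=
  map at_level (climb (phi u) (phi v) 1) ++
  None :: rev (map at_level (climb (phi v) (phi u) 0)).

Definition split_walk (i j : option T) : seq (G * nat) :=
  match i, j with
  | Some i, Some j => if i == u then zigzag true (p i j) else ground (p i j)
  | None, Some j => zigzag false (p u j)
  | _, None => [::]
  end.

Definition split_path (i j : option T) : seq M :=
  if (i == None) && (j == Some u) then split_loop
  else map at_level (split_walk i j).

Lemma sedge_short : sedge (phi u) (phi v).
Proof. by case: p_link => _ /(_ _ _ neq_uv)[]; rewrite p_uv /= andbT. Qed.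

(** The loop lies above the terminals [phi u] and [phi v], hence misses all
    lifts of internal vertices; and it avoids [phi u] at level 1, where only
    [phi v] is used, and level 0 altogether, hence misses all terminals. *)
Lemma mem_split_loop z : z \in split_loop ->
  z = None \/ exists k l, [/\ z = at_level (phi k, l), 0 < l <= n.+1
                           & l = 1 -> k = v].
Proof.
rewrite mem_cat inE mem_rev.
case/or3P=> [/mapP[a /mem_climb[//|-> /andP[lt_a le_a]] ->]|/eqP->|
             /mapP[a /mem_climb[//|-> /andP[lt_a le_a]] ->]];
  [right | by left | right].
  exists (if odd a.2 then u else v), a.2; rewrite le_a (ltnW lt_a).
  by split=> [|//|eq1]; [rewrite /rung; case: odd | rewrite eq1 in lt_a].
exists (if odd a.2 then v else u), a.2; rewrite le_a lt_a.
by split=> [|//|->//]; rewrite /rung; case: odd.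
Qed.

Lemma split_loopP :
  [/\ path (@sedge M) (at_level (split_terminal None))
            (rcons split_loop (at_level (split_terminal (Some u)))),
      uniq split_loop & ~~ odd (size split_loop)].
Proof.
have uv := sedge_short; have vu : sedge (phi v) (phi u) by rewrite sedge_sym.
split.
- rewrite rcons_cat rcons_cons -cat_rcons cat_path last_rcons.
  rewrite (path_climb (l := 1) uv) //=.
  by apply: path_rev_rcons (path_climb vu (leq0n _)); apply: sedge_sym.
- rewrite cat_uniq cons_uniq rev_uniq !at_level_uniq ?climb_low // !rungs_uniq.
  rewrite mem_rev none_at_level andbT -cat1s has_cat has_seq1 none_at_level.
  rewrite andbT andTb orFb.
  apply/hasPn=> z; rewrite mem_rev => /mapP[a a_down ->].
  have [eq_a /andP[_ le_a]] := mem_climb (leq0n _) a_down.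
  rewrite mem_at_level ?climb_low //; apply/negP=> /mem_climb[//|eq_a' _].
  have eq_uv : phi u = phi v.
    by move: eq_a; rewrite [in LHS]eq_a' => -[]; case: odd.
  by rewrite eq_uv sedge_irr in uv.
rewrite size_cat -cat1s size_cat size_rev !size_map !size_iota subSS !subn0.
by rewrite !oddD /=; case: odd.
Qed.

(** Each path other than the loop lies above the interior of one path of the
    base graph, that of [k] and [l]; [None] stands for [u] there. *)
Lemma mem_split_walk i j z : split_pair i j ->
    ~~ ((i == None) && (j == Some u)) -> z \in split_walk i j ->
  exists k l, [/\ k != l, z.1 \in p k l, z.2 <= 1,
    i = Some k \/ i = None /\ k = u & j = Some l].
Proof.
case: i j => [i|] [j|] //=.
  case/andP=> neq_ij neq_ju _.
  case: ifP => _ z_ij; exists i, j.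
    by have [z_p ?] := mem_zigzag z_ij; split=> //; left.
  by have [z_p ->] := mem_ground z_ij; split=> //; left.
move=> _ neq_ju /mem_zigzag[z_p le_z]; exists u, j; split=> //; last by right.
by apply: contraNneq neq_ju => ->.
Qed.

Lemma split_walkP i j : split_pair i j ->
    ~~ ((i == None) && (j == Some u)) ->
  [/\ path (@layer_adj G) (split_terminal i)
            (rcons (split_walk i j) (split_terminal j)),
      uniq (split_walk i j) & ~~ odd (size (split_walk i j))].
Proof.
have [_ p_path _ _] := p_link.
case: i j => [i|] [j|] //= => [/andP[neq_ij _] _|_ neq_ju].
  have [e_ij u_ij s_ij] := p_path i j neq_ij; case: ifP => _.
    by rewrite (path_zigzag true e_ij) zigzag_uniq // size_zigzag.
  by rewrite (path_ground false) // size_map map_inj_uniq // => x y [].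
have [|e_uj u_uj s_uj] := p_path u j; first by apply: contraNneq neq_ju => ->.
by rewrite (path_zigzag false e_uj) zigzag_uniq // size_zigzag.
Qed.

(** Two paths that meet lie above the same path of the base graph.  If they
    were different, they would be the two copies of one [p u b], whose zigzags
    are in opposite phases. *)
Lemma split_walk_disjoint i j k l z :
    split_pair i j -> ~~ ((i == None) && (j == Some u)) ->
    split_pair k l -> ~~ ((k == None) && (l == Some u)) ->
    z \in split_walk i j -> z \in split_walk k l ->
  [set i; j] = [set k; l].
Proof.
have [_ p_path _ p_disj] := p_link.
move=> r_ij not_ij r_kl not_kl z_ij z_kl.
have [a [b [neq_ab z_ab _ ia jb]]] := mem_split_walk r_ij not_ij z_ij.
have [c [d [neq_cd z_cd _ kc ld]]] := mem_split_walk r_kl not_kl z_kl.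
have eq_s := p_disj _ _ _ _ _ neq_ab neq_cd z_ab z_cd.
have neq_bu : b != u.
  move: r_ij not_ij; rewrite jb.
  by case: ia => [->|[-> _]] /=; [case/andP|].
have neq_du : d != u.
  move: r_kl not_kl; rewrite ld.
  by case: kc => [->|[-> _]] /=; [case/andP|].
have eq_bd : c = u -> a = u -> b = d.
  move=> eq_c eq_a; have : b \in [set c; d] by rewrite -eq_s !inE eqxx orbT.
  by rewrite eq_c !inE (negPf neq_bu) => /eqP.
have eq_uu : a = u <-> c = u.
  split=> [eq_a|eq_c].
    have : u \in [set c; d] by rewrite -eq_s eq_a !inE eqxx.
    by rewrite !inE [u == d]eq_sym (negPf neq_du) orbF => /eqP.
  have : u \in [set a; b] by rewrite eq_s eq_c !inE eqxx.
  by rewrite !inE [u == b]eq_sym (negPf neq_bu) orbF => /eqP.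
have clash e : e != u -> z \in zigzag true (p u e) ->
    z \notin zigzag false (p u e).
  by rewrite eq_sym => /p_path[_ u_ue _]; apply: zigzag_disjoint.
case: ia kc => [eq_i|[eq_i eq_a]] [eq_k|[eq_k eq_c]].
- have: Some @: [set a; b] = Some @: [set c; d] by rewrite eq_s.
  by rewrite !imsetU1 !imset_set1 eq_i eq_k jb ld.
- have eq_a := eq_uu.2 eq_c; move: z_ij z_kl.
  rewrite eq_i eq_k jb ld -(eq_bd eq_c eq_a) eq_a /= eqxx.
  by move=> /(clash b neq_bu)/negPf->.
- have eq_c := eq_uu.1 eq_a; move: z_ij z_kl.
  rewrite eq_i eq_k jb ld -(eq_bd eq_c eq_a) eq_c /= eqxx.
  by move=> z_f /(clash b neq_bu); rewrite z_f.
by rewrite eq_i eq_k jb ld eq_bd.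
Qed.

Lemma split_linkage :
  odd_linkage (at_level \o split_terminal) split_pair split_path.
Proof.
have [phi_inj p_path p_term p_disj] := p_link.
have low_term k : (split_terminal k).2 <= n.+1 by case: k.
have low_walk i j : split_pair i j -> ~~ ((i == None) && (j == Some u)) ->
    all (fun z => z.2 <= n.+1) (split_walk i j).
  move=> r_ij not_loop; apply/allP=> z /(mem_split_walk r_ij not_loop).
  by case=> [k [l [_ _ /leq_trans-> //]]].
have walk_term k l z : split_pair k l -> ~~ ((k == None) && (l == Some u)) ->
    z \in split_walk k l -> forall i l', z <> (phi i, l').
  move=> r_kl not_kl /(mem_split_walk r_kl not_kl)[a [b [neq_ab z_ab _ _ _]]].
  move=> i l' eq_z; have := p_term _ _ i neq_ab; rewrite eq_z in z_ab.
  by rewrite z_ab.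
have walk_loop i j z : split_pair i j -> ~~ ((i == None) && (j == Some u)) ->
    z \in map at_level (split_walk i j) -> z \notin split_loop.
  move=> r_ij not_ij /mapP[a a_ij ->]; apply/negP=> /mem_split_loop[//|].
  case=> k [l [/at_level_inj-eq_a /andP[_ le_l] _]].
  apply: (walk_term i j a r_ij not_ij a_ij k l); apply: eq_a => //.
  by apply: (allP (low_walk i j r_ij not_ij)).
split.
- move=> i j /= /at_level_inj=> /(_ (low_term i) (low_term j)).
  by case: i j => [i|] [j|] //= [/phi_inj->].
- move=> i j r_ij; rewrite /split_path; case: ifPn => [|not_loop].
    by case/andP=> /eqP-> /eqP->; apply: split_loopP.
  have [e_ij u_ij s_ij] := split_walkP r_ij not_loop.
  rewrite at_level_uniq ?low_walk // size_map -map_rcons path_at_level //.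
  by rewrite /= low_term all_rcons low_term low_walk.
- move=> i j k r_ij; rewrite /split_path; case: ifPn => [_|not_loop].
    apply/negP=> /mem_split_loop[//|[a [l [/at_level_inj-eq_a]]]].
    case/andP=> lt_l le_l l1.
    move: eq_a => /(_ (low_term k) le_l).
    case: k => [k|] /= [eq_a eq_l]; first by rewrite -eq_l in lt_l.
    move: (l1 (esym eq_l)) neq_uv => <-.
    by rewrite (phi_inj _ _ eq_a) eqxx.
  rewrite mem_at_level ?low_walk //; apply/negP=> /(walk_term _ _ _ r_ij not_loop).
  by case: k => [k|] /=; [move/(_ k 0) | move/(_ u 1)].
move=> i j k l z r_ij r_kl; rewrite /split_path.
case: ifPn => [/andP[/eqP-> /eqP->]|not_ij].
  case: ifPn => [/andP[/eqP-> /eqP->] //|not_kl] z_loop.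
  by move/(walk_loop _ _ _ r_kl not_kl); rewrite z_loop.
case: ifPn => [_ /(walk_loop _ _ _ r_ij not_ij)/negPf-> //|not_kl].
case/mapP=> a a_ij ->; rewrite mem_at_level ?low_walk //; last first.
  by apply: (allP (low_walk i j r_ij not_ij)).
exact: split_walk_disjoint.
Qed.

Lemma subdivision_short_path :
  contains_totally_odd_subdivision (complete_graph #|T|.+1) M.
Proof.
rewrite -card_option; apply: subdivision_of_linkage split_linkage => //.
  by move=> [i|] //=; rewrite eqxx.
move=> [i|] [j|] //= neq; have {neq} neq_ij : i != j by [].
rewrite [j == i]eq_sym neq_ij /=.
rewrite -negb_and; apply: contra neq_ij.
by case/andP=> /eqP-> /eqP->.
Qed.

End ShortPath.

(** * Joining all terminals to the apex *)

Section LongPaths.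
(** The conditions on [succ] make the pairs [{i, succ i}] distinct, so that the
    terminals climb along different paths. *)
Variable succ : T -> T.
Hypotheses (succ_neq : forall i, succ i != i)
           (succ2_neq : forall i, succ (succ i) != i)
           (p_nonnil : forall i j, i != j -> p i j != [::]).

Definition apex_terminal (i : option T) : M :=
  if i is Some i then at_level (phi i, 0) else None.

(** The path between [j] and [succ j] has to be read from [j], at the end where
    [j] has its ladder. *)
Definition apex_pair (i j : option T) : bool :=
  match i, j with
  | Some i, Some j => (i != j) && (i != succ j)
  | Some _, None => true
  | None, _ => false
  end.

Definition apex_walk (i j : option T) : seq (G * nat) :=
  match i, j with
  | Some i, Some j => if j == succ i then detour (p i j) else ground (p i j)
  | Some i, None => ladder (p i (succ i))
  | None, _ => [::]
  end.

Lemma mem_apex_walk i j z : apex_pair (Some i) j -> z \in apex_walk (Some i) j ->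
  [/\ i != odflt (succ i) j, z.1 \in p i (odflt (succ i) j) & z.2 <= n.+1].
Proof.
case: j => [j|] /=.
  case/andP=> neq_ij _; case: ifP => _.
    by case/mem_detour=> ? /leq_trans->.
  by case/mem_ground=> ? ->.
by move=> _ /mem_ladder[]; rewrite eq_sym.
Qed.

(** Each path lies above one path of the base graph, where a ladder at [i]
    counts for [i] and [succ i]; so only a ladder and the path that made room
    for it have to be compared. *)
Lemma apex_walk_disjoint i j k l z : apex_pair i j -> apex_pair k l ->
  z \in apex_walk i j -> z \in apex_walk k l -> [set i; j] = [set k; l].
Proof.
have [_ p_path _ p_disj] := p_link.
case: i k => [i|] // [k|] // r_ij r_kl z_ij z_kl.
have [neq_ij z_pij _] := mem_apex_walk r_ij z_ij.
have [neq_kl z_pkl _] := mem_apex_walk r_kl z_kl.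
have eq_s := p_disj _ _ _ _ _ neq_ij neq_kl z_pij z_pkl.
have u_succ a : uniq (p a (succ a)).
  by have [|_ ? _] := p_path a (succ a); rewrite // eq_sym.
have clash a b c : [set a; succ a] = [set b; c] -> apex_pair (Some b) (Some c) ->
    z \in ladder (p a (succ a)) -> z \in apex_walk (Some b) (Some c) -> False.
  move=> eq_abc /andP[_ neq_b] z_lad.
  have: succ a \in [set b; c] by rewrite -eq_abc !inE eqxx orbT.
  have: a \in [set b; c] by rewrite -eq_abc !inE eqxx.
  rewrite !inE => /orP[]/eqP eq_a /orP[]/eqP eq_sa.
  - by have := succ_neq a; rewrite eq_sa eq_a eqxx.
  - by rewrite /= -eq_a -eq_sa eqxx; apply/negP/ladder_detour_disjoint.
  - by rewrite -eq_a eq_sa eqxx in neq_b.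
  by have := succ_neq a; rewrite eq_sa eq_a eqxx.
case: j l r_ij r_kl z_ij z_kl {neq_ij neq_kl z_pij z_pkl} eq_s
  => [j|] [l|] r_ij r_kl z_ij z_kl /= eq_s.
- have: Some @: [set i; j] = Some @: [set k; l] by rewrite eq_s.
  by rewrite !imsetU1 !imset_set1.
- by case: (clash _ _ _ (esym eq_s) r_ij z_kl z_ij).
- by case: (clash _ _ _ eq_s r_kl z_ij z_kl).
suff -> : i = k by [].
have: i \in [set k; succ k] by rewrite -eq_s !inE eqxx.
rewrite !inE => /orP[/eqP//|/eqP eq_i].
have: succ i \in [set k; succ k] by rewrite -eq_s !inE eqxx orbT.
rewrite !inE => /orP[/eqP eq_k|/eqP eq_k].
  by have := succ2_neq k; rewrite -eq_i eq_k eqxx.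
by have := succ_neq i; rewrite eq_k eq_i eqxx.
Qed.

Lemma apex_linkage : odd_linkage apex_terminal apex_pair
  (fun i j => map at_level (apex_walk i j)).
Proof.
have [phi_inj p_path p_term p_disj] := p_link.
have low_walk i j : apex_pair i j -> all (fun z => z.2 <= n.+1) (apex_walk i j).
  case: i => [i|] // r_ij.
  by apply/allP=> z /(mem_apex_walk r_ij)[].
split.
- by move=> [i|] [j|] // /at_level_inj => /(_ isT isT)[/phi_inj->].
- move=> [i|] j // r_ij; rewrite at_level_uniq ?low_walk // size_map.
  case: j r_ij => [j|] r_ij; last first.
    have neq_i : i != succ i by rewrite eq_sym.
    have [e_i u_i s_i] := p_path _ _ neq_i.
    by apply: (ladderP e_i) => //; rewrite lt0n size_eq0 p_nonnil.
  have low_ij := low_walk _ _ r_ij.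
  case/andP: (r_ij) => neq_ij _; have [e_ij u_ij s_ij] := p_path _ _ neq_ij.
  rewrite -(map_rcons at_level _ (phi j, 0)).
  suff [e_w u_w s_w] : let s := apex_walk (Some i) (Some j) in
      [/\ path (@layer_adj G) (phi i, 0) (rcons s (phi j, 0)),
          uniq s & size s = size (p i j)].
    by rewrite path_at_level ?u_w ?s_w //= all_rcons low_ij.
  rewrite /=; case: ifP => _; first exact: detourP.
  by rewrite (path_ground false) // size_map map_inj_uniq // => ? ? [].
- move=> [i|] j k // r_ij; case: k => [k|]; last by rewrite none_at_level.
  rewrite mem_at_level ?low_walk //; apply/negP=> /(mem_apex_walk r_ij)[neq /= k_p _].
  by have := p_term _ _ k neq; rewrite k_p.
move=> i j k l z r_ij r_kl /mapP[a a_ij ->].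
have le_a := allP (low_walk _ _ r_ij) _ a_ij.
by rewrite mem_at_level ?low_walk //; apply: apex_walk_disjoint a_ij.
Qed.

Lemma subdivision_long_paths :
  contains_totally_odd_subdivision (complete_graph #|T|.+1) M.
Proof.
rewrite -card_option; apply: subdivision_of_linkage apex_linkage => //.
  by move=> [i|] //=; rewrite eqxx.
move=> [i|] [j|] //= neq; have {neq} neq_ij : i != j by [].
rewrite [j == i]eq_sym neq_ij /=.
rewrite -negb_and; apply: contraNN (succ2_neq j).
by case/andP=> /eqP {1}-> /eqP<-.
Qed.

End LongPaths.
End Linkage.
End Subdivisions.

(** * Small cases and conclusion *)

Lemma edge_linkage (G : sgraph) (x y : G) : sedge x y ->
  odd_linkage (fun b : bool => if b then x else y) (fun b c => b != c)
    (fun _ _ => [::]).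
Proof.
move=> xy; split=> // [[] [] //= eq_xy|[] [] //= _].
- by rewrite eq_xy sedge_irr in xy.
- by rewrite eq_xy sedge_irr in xy.
- by rewrite xy.
by rewrite sedge_sym xy.
Qed.

Lemma ordS_neq t (i : 'I_t.+2) : ordS i != i.
Proof.
rewrite -val_eqE /=; have := ltn_ord i; rewrite leq_eqVlt => /predU1P[eq_i|lt_i].
  by rewrite eq_i modnn; case: eqP => // i0; rewrite -i0 in eq_i.
by rewrite modn_small // gtn_eqF.
Qed.

Lemma ordS2_neq t (i : 'I_t.+3) : ordS (ordS i) != i.
Proof.
rewrite -val_eqE /= -addn1 modnDml addn1.
have [lt_i|] := ltnP i.+2 t.+3; first by rewrite modn_small // gtn_eqF // ltnW.
move=> le_i; have lt_i := ltn_ord i.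
rewrite -(subnK le_i) modnDr modn_small ?ltn_eqF //.
  by rewrite !subSS ltn_subLR // addSn ltnS leq_addl.
by rewrite !subSS; apply: leq_ltn_trans (leq_subr _ _) _.
Qed.

Theorem theorem1p8 (m t : nat) (hm : 2 <= m) (ht : 1 <= t) (G : sgraph) :
  contains_totally_odd_subdivision (complete_graph t) G ->
  contains_totally_odd_subdivision (complete_graph t.+1) (mycielskian m G).
Proof.
case: m hm => [|[|n]] // _.
case/linkage_of_subdivision=> phi [p p_link]; have [_ p_path _ _] := p_link.
case: t ht phi p p_link p_path => [|[|[|t]]] // _ phi p p_link p_path.
(* For [t = 1], an edge at the apex. *)
- have w_link := edge_linkage (sedge_at_level_top n (phi ord0)).
  apply: subdivision_of_linkage w_link; rewrite ?card_bool // => b.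
    by rewrite eqxx.
  by move=> c ->.
(* For [t = 2], the first edge of the path replaces it, so that a path of
   length one is available. *)
- have [|e_01 _ _] := p_path ord0 ord_max; first by [].
  have [x xy] : exists x, sedge (phi ord0) x.
    by case: (p _ _) e_01 => [|x s] /= /andP[]; [exists (phi ord_max) | exists x].
  have := subdivision_short_path n (edge_linkage xy) (u := true) (v := false).
  by rewrite card_bool; apply.
suff: contains_totally_odd_subdivision (complete_graph #|'I_t.+3|.+1)
    (mycielskian n.+2 G) by rewrite card_ord.
case: (pickP (fun ij => (ij.1 != ij.2) && nilp (p ij.1 ij.2))) => [[i j]|no_nil] /=.
  by case/andP=> neq_ij /nilP; apply: (subdivision_short_path n p_link neq_ij).
apply: (subdivision_long_paths n p_link (succ := @ordS t.+3)).
- exact: ordS_neq.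
- exact: ordS2_neq.
by move=> i j neq_ij; have := no_nil (i, j); rewrite /= neq_ij -size_eq0 /nilp /= => ->.
Qed.
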